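(* Let $\rho=\sum_I q_I\chi_I$ be an $n$-dimensional diagonal representation of $\mathbb Z_2^k$ for which the flip $\rho'$ of $\rho$ is defined. Then $$n_{B_1}=n_{B_2'},\qquad n_{B_2}=n_{B_1'},\qquad n_{B_I}=n_{B_I'}\quad\text{for every } I\subset\{1,\dots,k\},\ I\ne\{1\},\{2\}.$$ In particular, $\rho$ and $\rho'$ are almost-conjugate representations.
   Context: Let $k\ge2$ and let $f_1,\dots,f_k$ be the canonical basis of $\mathbb Z_2^k$. For $I\subset\{1,\dots,k\}$, $\chi_I:\mathbb Z_2^k\to\{\pm1\}$ is the character with $\chi_I(f_i)=-1$ if $i\in I$ and $\chi_I(f_i)=1$ if $i\notin I$. Fix a total order on the subsets of $\{1,\dots,k\}$ with $\emptyset$ first. A diagonal representation of $\mathbb Z_2^k$ is an injective homomorphism $\rho:\mathbb Z_2^k\to\mathrm{GL}_n(\mathbb Z)$ whose image consists of diagonal matrices. Writing $\rho=\sum_I q_I\chi_I$, with $q_I\in\mathbb Z_{\ge0}$ and $\sum_I q_I=n$, means that $\rho(f)$ is the diagonal matrix in which, taking the subsets $I$ in the fixed order, each entry $\chi_I(f)$ is repeated $q_I$ times. Flip: suppose that $$u=\frac1{2^{k-2}}\Big(\sum_{2\in I,\,1\notin I}q_I-\sum_{1\in I,\,2\notin I}q_I\Big)$$ is an integer, that $q_I-u\ge0$ whenever $2\in I,\ 1\notin I$, and that $q_I+u\ge0$ whenever $1\in I,\ 2\notin I$. Then the flip of $\rho$ is the diagonal representation $\rho'=\sum_I(q_I+u\delta_I)\chi_I$,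 where $\delta_I=1$ if $1\in I,\ 2\notin I$; $\delta_I=-1$ if $2\in I,\ 1\notin I$; and $\delta_I=0$ otherwise. For $I=\{i_1,\dots,i_h\}$ put $B_I=\rho(f_{i_1})\cdots\rho(f_{i_h})$ and $B_I'=\rho'(f_{i_1})\cdots\rho'(f_{i_h})$ (identity if $I=\emptyset$), with $B_j=B_{\{j\}}$, $B'_j=B'_{\{j\}}$. For a diagonal matrix $B$ with entries $\pm1$, $n_B=\dim(\mathbb R^n)^B$ is the number of diagonal entries equal to $1$. Two $n$-dimensional diagonal representations $\rho,\rho'$ are almost-conjugate if there is a bijection $\phi:\mathrm{Im}(\rho)\to\mathrm{Im}(\rho')$ such that $\phi(B)$ is conjugate to $B$ in $\mathrm O(n)$ for every $B\in\mathrm{Im}(\rho)$. *)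

(* Defs.v *)
From HB Require Import structures.
From mathcomp Require Import all_boot all_order all_algebra all_fingroup.
From mathcomp Require Import mxrepresentation.
From mathcomp Require Import reals.

Set Implicit Arguments.
Unset Strict Implicit.
Unset Printing Implicit Defensive.

Import Order.TTheory GRing.Theory Num.Theory.
Local Open Scope ring_scope.

(* Subsets of {1, .., k} are sets of ordinals, which are numbered from 0:
   the informal indices 1 and 2 are the ordinals [ix1] and [ix2] of values
   0 and 1. *)
Definition ix1 (k : nat) (hk : (1 < k)%N) : 'I_k := Ordinal (ltnW hk).
Definition ix2 (k : nat) (hk : (1 < k)%N) : 'I_k := Ordinal hk.

(* The group Z_2^k; as a finGroupType its law is addition (zmodMgE). *)
Notation Z2pow k := 'rV['Z_2]_k.

Definition fbasis (k : nat) (i : 'I_k) : Z2pow k := delta_mx 0 i.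

Definition chi (k : nat) (I : {set 'I_k}) (f : Z2pow k) : int :=
  \prod_(i in I) (-1) ^+ (f 0 i : nat).

Lemma chi_fbasis (k : nat) (I : {set 'I_k}) (i : 'I_k) :
  chi I (fbasis i) = if i \in I then -1 else 1.
Proof.
rewrite /chi /fbasis; case: ifPn => iI.
  rewrite (bigD1 i) //= mxE !eqxx big1 ?mulr1 // => j /andP[_ ji].
  by rewrite mxE (negPf ji) andbF.
rewrite big1 // => j jI; rewrite mxE eqxx /=.
by case: eqVneq => // ji; rewrite -ji jI in iI.
Qed.

Lemma chiM (k : nat) (I : {set 'I_k}) (f g : Z2pow k) :
  chi I (f * g)%g = chi I f * chi I g.
Proof.
rewrite /chi -big_split /=; apply: eq_bigr => i _.
rewrite mxE -exprD -signr_odd -[RHS]signr_odd /=.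
by rewrite modn2 oddb.
Qed.

Lemma chi1 (k : nat) (I : {set 'I_k}) : chi I 1%g = 1.
Proof. by rewrite /chi big1 // => i _; rewrite mxE. Qed.

Definition subset_order (k : nat) (le : rel {set 'I_k}) : Prop :=
  [/\ reflexive le, antisymmetric le, transitive le, total le
    & forall I, le set0 I].

(* Homomorphisms Z_2^k -> GL_n(Z); the values of an [mx_representation] are
   automatically invertible (repr_mx_unit). *)
Notation Zrep k n := (mx_representation int [set: Z2pow k] n).

Definition diagonal_rep (k n : nat) (rho : Zrep k n) : Prop :=
  injective rho /\ forall f, is_diag_mx (rho f).

(* The subsets in the order [le], each I being repeated q I times. *)
Definition chi_seq (k : nat) (le : rel {set 'I_k}) (q : {set 'I_k} -> nat) :
    seq {set 'I_k} :=
  flatten [seq nseq (q J) J | J <- sort le (enum {set 'I_k})].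

Definition chi_sum_mx (k : nat) (le : rel {set 'I_k}) (q : {set 'I_k} -> nat)
    (n : nat) (f : Z2pow k) : 'M[int]_n :=
  diag_mx (\row_j chi (nth set0 (chi_seq le q) j) f).

Lemma size_chi_seq (k : nat) (le : rel {set 'I_k}) (q : {set 'I_k} -> nat) :
  size (chi_seq le q) = (\sum_I q I)%N.
Proof.
rewrite size_flatten sumnE /shape -map_comp big_map.
rewrite (perm_big (enum {set 'I_k})) ?perm_sort //= big_enum /=.
by apply: eq_bigr => I _; rewrite size_nseq.
Qed.

Lemma chi_sum_mx_repr (k : nat) (le : rel {set 'I_k})
    (q : {set 'I_k} -> nat) (n : nat) :
  mx_repr [set: Z2pow k] (@chi_sum_mx k le q n).
Proof.
split=> [|f g _ _].
  by apply/matrixP => i j; rewrite !mxE chi1.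
rewrite /chi_sum_mx mulmx_diag; congr diag_mx.
by apply/rowP => j; rewrite !mxE chiM.
Qed.

(* The homomorphism sum_I q_I chi_I, meaningful when n = \sum_I q I. *)
Definition chi_sum_rep (k : nat) (le : rel {set 'I_k})
    (q : {set 'I_k} -> nat) (n : nat) : Zrep k n :=
  MxRepresentation (chi_sum_mx_repr le q n).

Definition is_chi_sum (k n : nat) (le : rel {set 'I_k})
    (q : {set 'I_k} -> nat) (rho : Zrep k n) : Prop :=
  (\sum_I q I)%N = n /\ forall f, rho f = chi_sum_rep le q n f.

Section Flip.
Variables (k : nat) (hk : (1 < k)%N) (q : {set 'I_k} -> nat).
Local Notation i1 := (ix1 hk).
Local Notation i2 := (ix2 hk).

Definition flip_u : rat :=
  (2 ^+ (k - 2))^-1 *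
  (\sum_(I : {set 'I_k} | (i2 \in I) && (i1 \notin I)) (q I)%:R
   - \sum_(I : {set 'I_k} | (i1 \in I) && (i2 \notin I)) (q I)%:R).

Definition flip_defined : Prop :=
  [/\ flip_u \is a Num.int,
      forall I : {set 'I_k}, i2 \in I -> i1 \notin I -> 0 <= (q I)%:R - flip_u
    & forall I : {set 'I_k}, i1 \in I -> i2 \notin I -> 0 <= (q I)%:R + flip_u].

Definition flip_delta (I : {set 'I_k}) : rat :=
  if (i1 \in I) && (i2 \notin I) then 1
  else if (i2 \in I) && (i1 \notin I) then -1 else 0.

(* When the flip is defined the truncation is exact: see flip_multE. *)
Definition flip_mult (I : {set 'I_k}) : nat :=
  Num.truncn ((q I)%:R + flip_u * flip_delta I).

Lemma flip_multE (I : {set 'I_k}) : flip_defined ->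
  (flip_mult I)%:R = (q I)%:R + flip_u * flip_delta I.
Proof.
case=> uZ h2 h1; apply: truncnK; rewrite natrEint.
apply/andP; split.
  have dZ : flip_delta I \is a Num.int.
    by rewrite /flip_delta; case: ifP => // _; case: ifP.
  by apply: rpredD; [exact: natr_int | exact: rpredM].
rewrite /flip_delta; case: ifPn => [/andP[? ?]|_]; first by rewrite mulr1 h1.
case: ifPn => [/andP[? ?]|_]; first by rewrite mulrN1 h2.
by rewrite mulr0 addr0 ler0n.
Qed.

Lemma flip_mult_sum : flip_defined ->
  (\sum_I flip_mult I = \sum_I q I)%N.
Proof.
move=> hf; apply/eqP; rewrite -(eqr_nat rat) !natr_sum; apply/eqP.
under eq_bigr => I _ do rewrite flip_multE //.
rewrite big_split /= -mulr_sumr -[RHS]addr0; congr (_ + _).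
have i12 : i1 != i2 by [].
pose s := [fun I : {set 'I_k} => tperm i1 i2 @: I].
have sK : involutive s.
  by move=> I; rewrite /= -imset_comp -[RHS]imset_id; apply: eq_imset => x /=;
     rewrite tpermK.
have s1 I : (i1 \in s I) = (i2 \in I).
  by rewrite /= -{1}(tpermR i1 i2) mem_imset //; apply: perm_inj.
have s2 I : (i2 \in s I) = (i1 \in I).
  by rewrite /= -{1}(tpermL i1 i2) mem_imset //; apply: perm_inj.
suff /eqP : \sum_I flip_delta I = - \sum_I flip_delta I.
  by rewrite -addr_eq0 -mulr2n mulrn_eq0 /= => /eqP ->; rewrite mulr0.
rewrite [LHS](reindex_inj (inv_inj sK)) -sumrN; apply: eq_bigr => I _.
by rewrite /flip_delta s1 s2; do 2![case: (_ \in I)]; rewrite /= ?oppr0 ?opprK.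
Qed.

Definition flip (le : rel {set 'I_k}) (n : nat) : Zrep k n :=
  chi_sum_rep le flip_mult n.

Lemma flip_is_chi_sum (le : rel {set 'I_k}) (n : nat) (rho : Zrep k n) :
  flip_defined -> is_chi_sum le q rho -> is_chi_sum le flip_mult (flip le n).
Proof. by move=> hf [hn _]; split=> //; rewrite flip_mult_sum. Qed.

End Flip.

Definition Bmx (k n : nat) (rho : Zrep k n) (I : {set 'I_k}) : 'M[int]_n :=
  \prod_(i in I) rho (fbasis i).

Definition real_mx (R : realType) (n : nat) (B : 'M[int]_n) : 'M[R]_n :=
  map_mx intr B.

(* [eigenspace] acts on row vectors, so the transpose gives the columns v
   with B v = v. *)
Definition nfix (R : realType) (n : nat) (B : 'M[int]_n) : nat :=
  \rank (eigenspace (real_mx R B)^T 1).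

Lemma nfix_diag (R : realType) (n : nat) (B : 'M[int]_n) :
  is_diag_mx B -> nfix R B = #|[set j | B j j == 1]|.
Proof.
move=> Bdiag; set A := [set j | B j j == 1].
pose d := \row_j (real_mx R B j j - 1).
have dE : (real_mx R B)^T - 1%:M = diag_mx d.
  apply/matrixP => i j; rewrite !mxE; case: (eqVneq i j) => [->|ij].
    by rewrite !mulr1n.
  by rewrite !mulr0n subr0 (is_diag_mxP Bdiag) // eq_sym.
pose e (i : 'I_#|A|) := enum_val i.
pose P : 'M[R]_(#|A|, n) := rowsub e 1%:M.
have PE i j : P i j = (e i == j)%:R by rewrite !mxE.
have Pfree : row_free P.
  apply/row_freeP; exists P^T; apply/matrixP => i j.
  rewrite mxE (bigD1 (e i)) //= big1 => [|l li].
    by rewrite [_^T _ _]mxE !PE eqxx mul1r addr0 mxE eq_sym (inj_eq enum_val_inj).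
  by rewrite PE eq_sym (negPf li) mul0r.
suff <- : \rank P = #|A|.
  rewrite /nfix /eigenspace dE; apply/eqP; rewrite eqn_leq.
  apply/andP; split; apply: mxrankS; last first.
    apply/sub_kermxP/matrixP => i j; rewrite mul_mx_diag [LHS]mxE PE !mxE.
    have [<-|] := eqVneq; last by rewrite mul0r.
    by have := enum_valP i; rewrite inE => /eqP ->; rewrite subrr mulr0.
  apply/rV_subP => v /sub_kermxP vd.
  apply/submxP; exists (\row_i v 0 (e i)); apply/rowP => j.
  have := congr1 (fun w : 'rV[R]_n => w 0 j) vd.
  rewrite mul_mx_diag !mxE => /eqP; rewrite mulf_eq0 subr_eq0 => vj.
  have [jA|jA] := boolP (j \in A).
    rewrite (bigD1 (enum_rank_in jA j)) //= PE mxE /e enum_rankK_in //.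
    rewrite eqxx mulr1 big1 ?addr0 // => i ij; rewrite PE.
    case: eqVneq => [ej|]; last by rewrite mulr0.
    by case/eqP: ij; apply: enum_val_inj; rewrite enum_rankK_in.
  rewrite big1 => [|i _]; last first.
    rewrite PE; case: eqVneq => [ej|]; last by rewrite mulr0.
    by rewrite -ej enum_valP in jA.
  case/orP: vj => [/eqP //|].
  by rewrite (eqr_int R _ 1) => Bj; rewrite inE Bj in jA.
by apply/eqP.
Qed.

Definition conj_in_O (R : realType) (n : nat) (A B : 'M[R]_n) : Prop :=
  exists2 P : 'M[R]_n, P *m P^T = 1%:M & B = P *m A *m P^T.

Definition Im_rep (k n : nat) (rho : Zrep k n) : Type :=
  {B : 'M[int]_n | B \in codom rho}.

Definition almost_conjugate (R : realType) (k n : nat)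
    (rho rho' : Zrep k n) : Prop :=
  [/\ diagonal_rep rho, diagonal_rep rho'
    & exists2 phi : Im_rep rho -> Im_rep rho', bijective phi
      & forall B, conj_in_O (real_mx R (val B)) (real_mx R (val (phi B)))].

(* Main.v *)
(** Write t(f) for the trace of rho f, that is the sum of the q_J chi_J(f).
  Since the indicator of m \in J is (1 - chi_J(f_m)) / 2, orthogonality of
  characters turns the sum of the delta_J chi_J(f) into
  2^(k-1) ([f = f_2] - [f = f_1]), while 2^(k-1) u = t(f_1) - t(f_2).
  Hence the flip exchanges the traces at f_1 and f_2 and preserves all others,
  and a diagonal matrix with entries 1 and -1 is determined up to a permutation
  of the coordinates by its trace. *)
Require Import Defs.
From mathcomp Require Import all_boot all_order all_algebra all_fingroup.
From mathcomp Require Import mxrepresentation.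
From mathcomp Require Import reals.
From mathcomp Require Import ring zify.
Import GRing.Theory Num.Theory.
Set Implicit Arguments.
Unset Strict Implicit.
Unset Printing Implicit Defensive.
Local Open Scope ring_scope.

(** * Character sums over all subsets *)

Lemma chi_signE (k : nat) (J : {set 'I_k}) (f : Z2pow k) :
  chi J f \in [:: 1; -1].
Proof.
rewrite /chi; apply: (big_ind (fun x : int => x \in [:: 1; -1])) => //.
  by move=> x y; rewrite !inE => /orP[] /eqP-> /orP[] /eqP->.
by move=> i _; rewrite -signr_odd; case: odd.
Qed.

(** The sum over subsets factors as the product over i of (-1)^(f_i) + 1, where a single coordinate
    f_i = 1 gives a zero factor. *)
Lemma sum_chi (k : nat) (f : Z2pow k) :
  \sum_J chi J f = if f == 1%g then 2 ^+ k else 0.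
Proof.
pose s i : int := (-1) ^+ (f 0 i : nat).
under eq_bigr => J _ do rewrite /chi big_mkcond.
rewrite -(bigA_distr _ _ s (fun=> 1)) /s.
case: eqVneq => [->|f1].
  under eq_bigr => i _ do rewrite mxE.
  by rewrite prodr_const card_ord.
have /rV0Pn[i fi] : f != 0 by [].
rewrite (bigD1 i) //=; case: (f 0 i) fi => [[|[|m]] hm] //= _.
by rewrite expr1 addNr mul0r.
Qed.

Lemma indicator_chi (k : nat) (J : {set 'I_k}) (i : 'I_k) :
  (i \in J)%:R = (1 - (chi J (fbasis i))%:~R) / 2 :> rat.
Proof. by rewrite chi_fbasis; case: ifP. Qed.

Lemma flip_deltaE (k : nat) (hk : (1 < k)%N) (J : {set 'I_k}) :
  flip_delta hk J = (ix1 hk \in J)%:R - (ix2 hk \in J)%:R.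
Proof.
by rewrite /flip_delta; do 2!case: (_ \in J); rewrite /= ?subrr ?subr0 ?sub0r.
Qed.

Lemma Z2_mulgg (k : nat) (f g : Z2pow k) : (f * g == 1)%g = (f == g).
Proof.
have gg : (g * g = 1)%g.
  by apply/rowP => i; rewrite !mxE; case: (g 0 i) => [[|[|m]] hm] //=;
    apply/val_inj.
by rewrite -(inj_eq (mulIg g)) -mulgA gg mulg1 mul1g.
Qed.

Lemma sum_delta_chi (k : nat) (hk : (1 < k)%N) (f : Z2pow k) :
  \sum_J flip_delta hk J * (chi J f)%:~R =
  2 ^+ k.-1 * ((f == fbasis (ix2 hk))%:R - (f == fbasis (ix1 hk))%:R).
Proof.
have E m : \sum_J (chi J (f * fbasis m)%g)%:~R
           = 2 ^+ k.-1 * 2 * (f == fbasis m)%:R :> rat.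
  rewrite -exprSr prednK ?(ltn_trans _ hk) // -rmorph_sum sum_chi Z2_mulgg.
  by case: eqP; rewrite ?rmorphXn ?mulr1 ?mulr0.
(* The constants of the two indicators cancel, so delta_J = (chi_J(f_2) - chi_J(f_1)) / 2; the
   factor chi_J(f) then shifts the arguments to f f_2 and f f_1. *)
have -> : \sum_J flip_delta hk J * (chi J f)%:~R =
    (\sum_J (chi J (f * fbasis (ix2 hk))%g)%:~R
     - \sum_J (chi J (f * fbasis (ix1 hk))%g)%:~R) / 2.
  rewrite -sumrB mulr_suml; apply: eq_bigr => J _.
  by rewrite flip_deltaE !indicator_chi !chiM !rmorphM /=; field.
by rewrite !E; field.
Qed.

(** * Traces, and their change under the flip *)

Definition chi_trace (k : nat) (q : {set 'I_k} -> nat) (f : Z2pow k) : rat :=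
  \sum_J (q J)%:R * (chi J f)%:~R.

Section FlipTrace.
Variables (k : nat) (hk : (1 < k)%N) (q : {set 'I_k} -> nat).
Local Notation f1 := (fbasis (ix1 hk)).
Local Notation f2 := (fbasis (ix2 hk)).

Lemma fbasis12_neq : (f1 == f2) = false.
Proof.
by apply/negP => /eqP /(congr1 (chi [set ix1 hk])); rewrite !chi_fbasis !inE.
Qed.

Lemma flip_u_trace : flip_u hk q * 2 ^+ k.-1 = chi_trace q f1 - chi_trace q f2.
Proof.
(* Exact because [hk] rules out truncation; the extra factor 2 absorbs the denominator of the
   indicators. *)
have ek : k.-1 = (k - 2).+1 by lia.
have ind m m' : \sum_(J : {set 'I_k} | (m \in J) && (m' \notin J)) (q J)%:R
   = \sum_J (q J)%:R * ((m \in J)%:R * (1 - (m' \in J)%:R)) :> rat.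
  rewrite big_mkcond; apply: eq_bigr => J _.
  by do 2!case: (_ \in J); rewrite /= ?subr0 ?subrr ?mulr1 ?mulr0.
rewrite /flip_u /chi_trace !ind -!sumrB ek exprSr mulrACA.
rewrite mulVf ?expf_neq0 // mul1r.
rewrite mulr_suml; apply: eq_bigr => J _; rewrite !indicator_chi; field.
by [].
Qed.

(** The flip adds (t(f_1) - t(f_2)) ([f = f_2] - [f = f_1]) to t(f). Writing the result with a
    transposition lets one permutation serve both the dimensions and the almost-conjugacy. *)
Lemma flip_trace (f : Z2pow k) : flip_defined hk q ->
  chi_trace (flip_mult hk q) f = chi_trace q (tperm f1 f2 f).
Proof.
move=> hf; rewrite {1}/chi_trace.
under eq_bigr => J _ do rewrite flip_multE // mulrDl -mulrA.
rewrite big_split /= -/(chi_trace q f) -mulr_sumr sum_delta_chi mulrA.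
rewrite flip_u_trace.
case: tpermP => [->|->|/eqP/negPf-> /eqP/negPf->].
- by rewrite eqxx fbasis12_neq /=; ring.
- by rewrite eqxx eq_sym fbasis12_neq /=; ring.
- by rewrite subrr mulr0 addr0.
Qed.

End FlipTrace.

Lemma chi_sum_rep_trace (k : nat) (le : rel {set 'I_k})
    (q : {set 'I_k} -> nat) (n : nat) (f : Z2pow k) : (\sum_J q J)%N = n ->
  (\tr (chi_sum_rep le q n f))%:~R = chi_trace q f.
Proof.
move=> hn; rewrite /= mxtrace_diag.
under eq_bigr => j _ do rewrite mxE.
rewrite -(big_mkord xpredT (fun j => chi (nth set0 (chi_seq le q) j) f)).
(* As the q_J sum to n, the list [chi_seq] has length n and [nth] never falls back on its default
   [set0]. *)
rewrite -hn -(size_chi_seq le q) -(big_nth set0 xpredT (fun J => chi J f)).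
rewrite rmorph_sum /= big_flatten big_map.
rewrite (perm_big (enum {set 'I_k})) ?perm_sort //= big_enum /=.
by apply: eq_bigr => J _; rewrite big_nseq iter_addr addr0 mulr_natl.
Qed.

(** * Diagonal matrices with entries 1 and -1 *)

Definition sign_diag (n : nat) (A : 'M[int]_n) : Prop :=
  is_diag_mx A /\ forall j, A j j \in [:: 1; -1].

Lemma chi_sum_rep_sign_diag (k : nat) (le : rel {set 'I_k})
    (q : {set 'I_k} -> nat) (n : nat) (f : Z2pow k) :
  sign_diag (chi_sum_rep le q n f).
Proof.
split; first exact: diag_mx_is_diag.
by move=> j; rewrite !mxE eqxx mulr1n chi_signE.
Qed.

(** Each diagonal entry e equals 2 [e = 1] - 1. *)
Lemma sign_diag_trace (n : nat) (A : 'M[int]_n) : sign_diag A ->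
  \tr A = #|[set j | A j j == 1]|%:R *+ 2 - n%:R.
Proof.
case=> _ sA; rewrite -sum1_card natr_sum -sumrMnl.
rewrite big_mkcond -[X in _ - X%:R]card_ord -sum1_card natr_sum -sumrB.
apply: eq_bigr => j _; rewrite inE.
by have := sA j; rewrite !inE => /orP[] /eqP->.
Qed.

Lemma sign_diag_eq_card (n : nat) (A B : 'M[int]_n) :
  sign_diag A -> sign_diag B -> \tr A = \tr B ->
  #|[set j | A j j == 1]| = #|[set j | B j j == 1]|.
Proof. by move=> /sign_diag_trace -> /sign_diag_trace ->; lia. Qed.

(** The number of entries 1 determines how many diagonal entries satisfy any given predicate, so
    both diagonals are the same multiset. *)
Lemma sign_diag_perm (n : nat) (A B : 'M[int]_n) :
  sign_diag A -> sign_diag B -> \tr A = \tr B ->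
  exists s : 'S_n, forall j, B j j = A (s j) (s j).
Proof.
move=> sA sB tAB; have cAB := sign_diag_eq_card sA sB tAB.
pose d (C : 'M[int]_n) := [tuple C j j | j < n].
have dE (C : 'M[int]_n) (P : pred int) : sign_diag C -> count P (d C)
    = (P 1%R * #|[set j | C j j == 1]| + P (-1)%R * #|~: [set j | C j j == 1]|)%N.
  case=> _ sC; rewrite count_map -sum1_count big_enum_cond /=.
  rewrite -!sum1_card !big_distrr /= big_mkcond /= [RHS]addnC.
  rewrite [X in (_ + X)%N]big_mkcond [X in (X + _)%N]big_mkcond -big_split.
  apply: eq_bigr => j _; rewrite !inE /=.
  by have := sC j; rewrite !inE => /orP[] /eqP->; case: (P _).
have cC (C : {set 'I_n}) : #|~: C| = (n - #|C|)%N.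
  by have := cardsC C; rewrite card_ord; lia.
have /tuple_permP[s sE] : perm_eq (d B) (d A).
  by apply/seq.permP => P; rewrite !dE // !cC cAB.
exists s => j; have := congr1 (fun t => nth 0 t j) sE.
by rewrite -!tnth_nth !tnth_mktuple.
Qed.

Lemma sign_diag_conj (R : realType) (n : nat) (A B : 'M[int]_n) :
  sign_diag A -> sign_diag B -> \tr A = \tr B ->
  conj_in_O (real_mx R A) (real_mx R B).
Proof.
move=> sA sB tAB; have [s sE] := sign_diag_perm sA sB tAB.
exists (perm_mx s); first by rewrite tr_perm_mx -perm_mxM mulgV perm_mx1.
rewrite tr_perm_mx -row_permE -col_permE; apply/matrixP => i j.
rewrite !mxE; have [<-|ij] := eqVneq i j; first by rewrite sE.
case: sA sB => /is_diag_mxP dA _ [/is_diag_mxP dB _].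
by rewrite dA ?dB ?(inj_eq val_inj) ?(inj_eq perm_inj).
Qed.

Lemma sign_diag_nfix (R : realType) (n : nat) (A B : 'M[int]_n) :
  sign_diag A -> sign_diag B -> \tr A = \tr B -> nfix R A = nfix R B.
Proof.
move=> sA sB tAB; case: (sA) (sB) => dA _ [dB _].
by rewrite !nfix_diag // (sign_diag_eq_card sA sB tAB).
Qed.

(** * Products of basis elements and images of representations *)

Definition fset_sum (k : nat) (I : {set 'I_k}) : Z2pow k :=
  (\prod_(i in I) fbasis i)%g.

Lemma fset_sum1 (k : nat) (i : 'I_k) : fset_sum [set i] = fbasis i.
Proof. by rewrite /fset_sum big_set1. Qed.

(** The group law being addition, [fset_sum I] is the indicator vector of I; the character of a
    singleton reads off one coordinate, which yields injectivity. *)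
Lemma chi_fset_sum (k : nat) (I : {set 'I_k}) (i : 'I_k) :
  chi [set i] (fset_sum I) = if i \in I then -1 else 1.
Proof.
rewrite /fset_sum (big_morph _ (chiM _) (chi1 _)).
under eq_bigr => j _ do rewrite chi_fbasis inE eq_sym.
have [iI|iI] := boolP (i \in I).
  by rewrite (bigD1 i) //= eqxx big1 // => j /andP[_ /negPf]; rewrite eq_sym => ->.
by rewrite big1 // => j jI; case: eqP => // ij; rewrite ij jI in iI.
Qed.

Lemma fset_sum_inj (k : nat) : injective (@fset_sum k).
Proof.
move=> I J IJ; apply/setP => i; have := chi_fset_sum I i.
by rewrite IJ chi_fset_sum; do 2!case: (_ \in _).
Qed.

Lemma Bmx_fset_sum (k n : nat) (rho : Zrep k n) (I : {set 'I_k}) :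
  Bmx rho I = rho (fset_sum I).
Proof.
rewrite /Bmx /fset_sum; symmetry; apply: (big_morph rho).
  by move=> f g; rewrite repr_mxM ?inE.
by rewrite repr_mx1.
Qed.

Section ImRep.
Variables (k n : nat) (rho : Zrep k n).

Definition to_Im (f : Z2pow k) : Im_rep rho := exist _ (rho f) (codom_f rho f).
(** [iinv] chooses some preimage, the only one when [rho] is injective. *)
Definition of_Im (B : Im_rep rho) : Z2pow k := iinv (valP B).

Lemma of_ImK : cancel of_Im to_Im.
Proof. by move=> B; apply: val_inj; rewrite /= f_iinv. Qed.

Lemma to_ImK : injective rho -> cancel to_Im of_Im.
Proof. by move=> rho_inj f; apply: rho_inj; rewrite f_iinv. Qed.

End ImRep.

(** Almost-conjugacy asks for a mere bijection of images, so a permutation of the group, carried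
    over as rho f -> rho' (s f), provides one. *)
Lemma almost_conjugate_perm (R : realType) (k n : nat) (rho rho' : Zrep k n)
    (s : {perm Z2pow k}) :
  diagonal_rep rho -> diagonal_rep rho' ->
  (forall f, conj_in_O (real_mx R (rho f)) (real_mx R (rho' (s f)))) ->
  almost_conjugate R rho rho'.
Proof.
move=> dr dr' sC; split=> //.
exists (fun B => to_Im rho' (s (of_Im B))).
  exists (fun B => to_Im rho (s^-1%g (of_Im B))) => B.
    by rewrite to_ImK ?permK ?of_ImK //; case: dr'.
  by rewrite to_ImK ?permKV ?of_ImK //; case: dr.
by move=> B /=; rewrite -{1}(of_ImK B); exact: sC.
Qed.

Lemma repr_injective (k n : nat) (rho : Zrep k n) :
  (forall f, rho f = 1%:M -> f = 1%g) -> injective rho.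
Proof.
move=> ker1 f g fg; apply/eqP; rewrite -Z2_mulgg; apply/eqP/ker1.
rewrite repr_mxM ?inE // fg -repr_mxM ?inE //.
by have /eqP-> := etrans (Z2_mulgg g g) (eqxx g); rewrite repr_mx1.
Qed.

Theorem theorem2p6 (R : realType) (k : nat) (hk : (1 < k)%N)
    (le : rel {set 'I_k}) (hle : subset_order le)
    (n : nat) (rho : Zrep k n) (q : {set 'I_k} -> nat)
    (hdiag : diagonal_rep rho) (hrho : is_chi_sum le q rho)
    (hflip : flip_defined hk q) :
  let rho' := flip hk q le n in
  [/\ nfix R (Bmx rho [set ix1 hk]) = nfix R (Bmx rho' [set ix2 hk]),
      nfix R (Bmx rho [set ix2 hk]) = nfix R (Bmx rho' [set ix1 hk]),
      forall I : {set 'I_k}, I != [set ix1 hk] -> I != [set ix2 hk] ->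
        nfix R (Bmx rho I) = nfix R (Bmx rho' I)
    & almost_conjugate R rho rho'].
Proof.
move=> rho'; pose s := tperm (fbasis (ix1 hk)) (fbasis (ix2 hk)).
have [hn rhoE] := hrho.
have sd f : sign_diag (rho f) by rewrite rhoE; apply: chi_sum_rep_sign_diag.
have sd' f : sign_diag (rho' f) by apply: chi_sum_rep_sign_diag.
have trE f : \tr (rho f) = \tr (rho' (s f)).
  apply: (@intr_inj rat); rewrite rhoE !chi_sum_rep_trace ?flip_mult_sum //.
  by rewrite flip_trace // tpermK.
have nfixE I J : s (fset_sum I) = fset_sum J ->
    nfix R (Bmx rho I) = nfix R (Bmx rho' J).
  by move=> IJ; rewrite !Bmx_fset_sum -IJ; apply: sign_diag_nfix.
split.
- by apply: nfixE; rewrite !fset_sum1 tpermL.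
- by apply: nfixE; rewrite !fset_sum1 tpermR.
- move=> I I1 I2; apply: nfixE; rewrite tpermD // -fset_sum1.
    by rewrite (inj_eq (@fset_sum_inj k)) eq_sym.
  by rewrite (inj_eq (@fset_sum_inj k)) eq_sym.
- apply: (almost_conjugate_perm (s := s)) => // [|f]; last exact: sign_diag_conj.
  split=> [|f]; last by case: (sd' f).
  (* Faithfulness passes from [rho] to [rho'] because only the identity is conjugate to the
     identity. *)
  have rho1 f : rho' (s f) = 1%:M -> f = 1%g.
    move=> f1; have [P PP] := sign_diag_conj R (sd' _) (sd f) (esym (trE f)).
    rewrite f1 /real_mx map_mx1 mulmx1 PP -(map_mx1 intr) => fE.
    case: hdiag => rho_inj _; apply: rho_inj; rewrite repr_mx1.
    apply/matrixP => i j; apply: (@intr_inj R).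
    by have /matrixP/(_ i j) := fE; rewrite !mxE.
  (* Since s is an involution, [rho1] applies to s 1, and below to s f. *)
  have s1 : s 1%g = 1%g.
    by apply: rho1; rewrite tpermK repr_mx1.
  apply: repr_injective => f f1; rewrite -s1.
  by rewrite -(rho1 (s f)) ?tpermK.
Qed.
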